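(* Let $R$ be any one of the following four subsets of $\{0,1,2,3\}^2$: (A33) $\{(0,2),(1,0),(1,1),(1,2),(2,2),(3,0),(3,1),(3,2)\}$; (A34) $\{(0,1),(0,2),(0,3),(1,1),(2,1),(2,2),(2,3),(3,1)\}$; (A35) $\{(0,1),(0,3),(1,1),(1,3),(2,0),(2,1),(2,2),(2,3)\}$; (A36) $\{(1,0),(1,1),(1,2),(1,3),(2,0),(2,2),(3,0),(3,2)\}$. Let $q_1=(123,R)$, $q_2=(321,R)$. Then $q_1$ and $q_2$ are jointly equidistributed. Moreover, letting $T_{n,k,\ell}$ be the number of $\pi\in S_n$ with exactly $k$ occurrences of $q_1$ and exactly $\ell$ occurrences of $q_2$ (with $T_{n,k,\ell}=0$ whenever $k<0$ or $\ell<0$), for $n\ge 4$ \[ T_{n,k,\ell}=(n-2)T_{n-1,k,\ell}+T_{n-1,k-1,\ell}+T_{n-1,k,\ell-1}+T_{n-2,k,\ell}-T_{n-2,k-1,\ell-1}, \] with initial conditions $T_{2,0,0}=2$, $T_{3,0,0}=4$, $T_{3,1,0}=T_{3,0,1}=1$, and $T_{n,k,\ell}=0$ for $k,\ell\ge n-1$. Equivalently, with $T_n(x,y)=\sum_{k=0}^{n-2}\sum_{\ell=0}^{n-2}T_{n,k,\ell}x^ky^\ell$, \[ T_n(x,y)=(n+x+y-2)T_{n-1}(x,y)+(1-xy)T_{n-2}(x,y),\qquad n\ge 4, \] with $T_2(x,y)=2$ and $T_3(x,y)=x+y+4$.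
   Context: $S_n$ is the set of permutations of $\{1,\dots,n\}$. A mesh pattern of length $k$ is a pair $(\tau,R)$ with $\tau\in S_k$ and $R\subseteq\{0,\dots,k\}^2$; the element $(a,b)\in R$ is the ''shaded box'' whose corners are $(a,b),(a,b+1),(a+1,b+1),(a+1,b)$ in the plot of $\tau$ (first coordinate = position, second = value). An occurrence of $(\tau,R)$ in $\pi=\pi_1\cdots\pi_n\in S_n$ is a tuple of indices $i_1<\dots<i_k$ such that $\pi_{i_1}\cdots\pi_{i_k}$ is order-isomorphic to $\tau$ and, setting $i_0=0$, $i_{k+1}=n+1$, letting $v_1<\dots<v_k$ be the values $\pi_{i_1},\dots,\pi_{i_k}$ in increasing order and $v_0=0$, $v_{k+1}=n+1$, for every $(a,b)\in R$ there is no index $m$ with $i_a<m<i_{a+1}$ and $v_b<\pi_m<v_{b+1}$. The number of occurrences is the number of such index tuples. Two mesh patterns $q_1,q_2$ are jointly equidistributed if for all $n\ge 1$ and all integers $k,\ell\ge 0$, the number of $\pi\in S_n$ with exactly $k$ occurrences of $q_1$ and exactly $\ell$ occurrences of $q_2$ equals the number with exactly $\ell$ occurrences of $q_1$ and exactly $k$ occurrences of $q_2$. *)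

(* Defs.v *)
From mathcomp Require Import all_boot all_order all_fingroup all_algebra.

Set Implicit Arguments.
Unset Strict Implicit.
Unset Printing Implicit Defensive.

Import GRing.Theory.

(* Positions and values of a permutation pi : 'S_n are 0-based; the boundaries
   [cut_pos] and [cut_val] below are 1-based, with sentinels 0 and n.+1.
   The box (a, b) of the shading is (column, row) = (position, value). *)
Definition mesh_pattern (k : nat) : Type :=
  ('S_k * {set 'I_k.+1 * 'I_k.+1})%type.

Section Occurrences.
Variables (k n : nat) (q : mesh_pattern k) (pi : 'S_n).

Definition order_isomorphic (i : k.-tuple 'I_n) : bool :=
  [forall a : 'I_k, forall b : 'I_k,
     (pi (tnth i a) < pi (tnth i b)) == (q.1 a < q.1 b)].

(* i_0 = 0 < i_1 < ... < i_k < i_(k+1) = n+1 *)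
Definition cut_pos (i : k.-tuple 'I_n) : seq nat :=
  0 :: rcons [seq (val j).+1 | j <- i] n.+1.

(* v_0 = 0 < v_1 < ... < v_k < v_(k+1) = n+1 *)
Definition cut_val (i : k.-tuple 'I_n) : seq nat :=
  0 :: rcons (sort leq [seq (val (pi j)).+1 | j <- i]) n.+1.

Definition in_box (i : k.-tuple 'I_n) (a b : nat) (m : 'I_n) : bool :=
  (nth 0 (cut_pos i) a < m.+1 < nth 0 (cut_pos i) a.+1) &&
  (nth 0 (cut_val i) b < (pi m).+1 < nth 0 (cut_val i) b.+1).

Definition occurrence (i : k.-tuple 'I_n) : bool :=
  [&& sorted ltn [seq val j | j <- i],
      order_isomorphic i &
      [forall ab in q.2, forall m : 'I_n, ~~ in_box i ab.1 ab.2 m]].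

Definition num_occ : nat := #|[set i : k.-tuple 'I_n | occurrence i]|.

End Occurrences.

(* The indices k, l are integers so that the count is 0 at negative indices. *)
Definition joint_count (k1 k2 : nat) (q1 : mesh_pattern k1)
    (q2 : mesh_pattern k2) (n : nat) (k l : int) : nat :=
  #|[set pi : 'S_n | ((num_occ q1 pi)%:Z%R == k) &&
                     ((num_occ q2 pi)%:Z%R == l)]|.

Definition jointly_equidistributed (k1 k2 : nat) (q1 : mesh_pattern k1)
    (q2 : mesh_pattern k2) : Prop :=
  forall (n : nat) (k l : nat), 1 <= n ->
    joint_count q1 q2 n k%:Z%R l%:Z%R = joint_count q1 q2 n l%:Z%R k%:Z%R.

(* {poly {poly int}} is Z[x, y] with x = 'X (outer) and y = 'Y = 'X%:P. *)
Definition joint_poly (k1 k2 : nat) (q1 : mesh_pattern k1)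
    (q2 : mesh_pattern k2) (n : nat) : {poly {poly int}} :=
  (\sum_(0 <= k < n.-1) \sum_(0 <= l < n.-1)
     (joint_count q1 q2 n k%:Z l%:Z)%:R * 'X ^+ k * 'Y ^+ l)%R.

Definition perm123 : 'S_3 := 1%g.
Definition perm321 : 'S_3 := perm (@rev_ord_inj 3).

Definition boxes (s : seq (nat * nat)) : {set 'I_4 * 'I_4} :=
  [set ab : 'I_4 * 'I_4 | (val ab.1, val ab.2) \in s].

Definition A33 : {set 'I_4 * 'I_4} :=
  boxes [:: (0,2); (1,0); (1,1); (1,2); (2,2); (3,0); (3,1); (3,2)].
Definition A34 : {set 'I_4 * 'I_4} :=
  boxes [:: (0,1); (0,2); (0,3); (1,1); (2,1); (2,2); (2,3); (3,1)].
Definition A35 : {set 'I_4 * 'I_4} :=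
  boxes [:: (0,1); (0,3); (1,1); (1,3); (2,0); (2,1); (2,2); (2,3)].
Definition A36 : {set 'I_4 * 'I_4} :=
  boxes [:: (1,0); (1,1); (1,2); (1,3); (2,0); (2,2); (3,0); (3,2)].

(* Main.v *)
(* The four shadings form one orbit under inversion (transposing the boxes) and
   rotation by 180 degrees, and both operations fix 123 and 321, so it suffices
   to treat A35.  There the last two letters of an occurrence are adjacent, and
   position z is the last position of at most one occurrence of each pattern:
   of q1 iff pi_z is the maximum of the prefix ending at z and pi_(z-1) is not
   the minimum of the prefix ending at z-1; of q2 iff pi_z is the immediate
   predecessor of pi_(z-1) among the values of the prefix and pi_(z-1) is not
   the maximum of the prefix ending at z-1.  Hence appending a last value p to s
   multiplies the weight x^#q1 y^#q2 by x if p is maximal and the last value of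
   s is not minimal, by y if p is inserted just below the last value of s and
   the latter is not maximal, and by 1 otherwise.  If F_n and L_n are the parts
   of T_n with minimal, respectively maximal, last value, this reads
     T_(n+1) = (n-1+x+y) T_n + (1-x) F_n + (1-y) L_n,
     F_(n+1) = T_n + (y-1) F_n,   L_(n+1) = x T_n + (1-x) F_n,
   and eliminating F and L gives the recurrence. *)
Require Import Defs.
From mathcomp Require Import all_boot all_order all_fingroup all_algebra.
From mathcomp Require Import zify ring.

Set Implicit Arguments.
Unset Strict Implicit.
Unset Printing Implicit Defensive.

Import GRing.Theory.

(** * Occurrences of 123 and 321 as triples of positions *)

Definition triple (n : nat) : Type := ('I_n * 'I_n * 'I_n)%type.

Definition monotone_perm (b : bool) : 'S_3 := if b then perm321 else perm123.

Definition increasing (n : nat) (t : triple n) : bool := t.1.1 < t.1.2 < t.2.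

Definition cuts (n : nat) (t : triple n) : seq nat :=
  [:: 0; t.1.1.+1; t.1.2.+1; t.2.+1; n.+1].

(* Increasing exactly when [s] restricted to [t] is order isomorphic to
   [monotone_perm b]. *)
Definition value_triple (n : nat) (b : bool) (s : 'S_n) (t : triple n) :
    triple n :=
  if b then (s t.2, s t.1.2, s t.1.1) else (s t.1.1, s t.1.2, s t.2).

Definition in_gap (c : seq nat) (a m : nat) : bool :=
  nth 0 c a < m < nth 0 c a.+1.

Definition respects_shading (n : nat) (R : {set 'I_4 * 'I_4}) (s : 'S_n)
    (t u : triple n) : bool :=
  [forall ab in R, forall m : 'I_n,
     ~~ (in_gap (cuts t) ab.1 m.+1 && in_gap (cuts u) ab.2 (s m).+1)].

Definition monotone_occurrence (n : nat) (b : bool) (R : {set 'I_4 * 'I_4})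
    (s : 'S_n) (t : triple n) : bool :=
  [&& increasing t, increasing (value_triple b s t)
    & respects_shading R s t (value_triple b s t)].

Lemma monotone_permE (b : bool) (i : 'I_3) :
  monotone_perm b i = if b then rev_ord i else i.
Proof. by case: b; rewrite /= ?permE. Qed.

Lemma forall_ord3 (P : pred 'I_3) :
  [forall i, P i] = [&& P ord0, P (inord 1) & P ord_max].
Proof.
apply/forallP/and3P => [H | [H0 H1 H2] i]; first by split.
have [|[]] : i = ord0 \/ i = inord 1 \/ i = ord_max; last by move->.
- case: i => [[|[|[|//]]] p].
  + by left; apply: val_inj.
  + by right; left; apply: val_inj; rewrite /= inordK.
  + by right; right; apply: val_inj.
- by move->.
- by move->.
Qed.

Lemma sort_rev3 (x y z : nat) : z < y < x -> sort leq [:: x; y; z] = [:: z; y; x].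
Proof.
move=> h; apply: (sorted_eq leq_trans anti_leq).
- exact/sort_sorted/leq_total.
- by rewrite /=; lia.
- by rewrite perm_sort -[X in perm_eq X _]revK perm_rev.
Qed.

Lemma sort3 (x y z : nat) : x < y < z -> sort leq [:: x; y; z] = [:: x; y; z].
Proof. by move=> h; apply: sorted_sort; [exact: leq_trans | rewrite /=; lia]. Qed.

(** Once positions and [value_triple] are increasing, sorting the values at [x], [y], [z] yields the
    entries of [value_triple], so both boundary lists take the form [cuts]. *)
Lemma occurrence_triple (n : nat) (b : bool) (R : {set 'I_4 * 'I_4})
    (s : 'S_n) (x y z : 'I_n) :
  occurrence (monotone_perm b, R) s [tuple x; y; z] =
  monotone_occurrence b R s (x, y, z).
Proof.
rewrite /occurrence /monotone_occurrence /increasing /=.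
rewrite andbT; case hxy: (x < y); last by [].
case hyz: (y < z); last by []. rewrite /=.
have -> : order_isomorphic (monotone_perm b, R) s [tuple x; y; z] =
   increasing (value_triple b s (x, y, z)).
  rewrite /order_isomorphic !forall_ord3 !monotone_permE !(tnth_nth x) /= !inordK //=.
  rewrite /increasing.
  by case: (b) => /=; rewrite ?inordK //; lia.
rewrite -/(increasing (value_triple b s (x, y, z))).
case hv: (increasing _); last by [].
rewrite /=; apply: eq_forallb => ab; congr (_ ==> _); apply: eq_forallb => m.
rewrite /in_box /in_gap /cuts /cut_pos /cut_val /=.
move: hv; rewrite /increasing; case: (b) => /= hv.
  by rewrite sort_rev3.
by rewrite sort3.
Qed.

Lemma num_occ_monotone (n : nat) (b : bool) (R : {set 'I_4 * 'I_4}) (s : 'S_n) :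
  num_occ (monotone_perm b, R) s = #|[set t | monotone_occurrence b R s t]|.
Proof.
pose f (t : triple n) : 3.-tuple 'I_n := [tuple t.1.1; t.1.2; t.2].
have f_inj : injective f by move=> [[x y] z] [[x' y'] z'] [-> -> ->].
rewrite /num_occ -(card_imset _ f_inj); apply: eq_card => i.
rewrite inE; apply/idP/imsetP => [|[[[x y] z]]].
  case/tupleP: i => x i; case/tupleP: i => y i; case/tupleP: i => z i.
  rewrite (tuple0 i).
  have -> : [tuple of x :: [tuple of y :: [tuple of z :: [tuple]]]] = [tuple x; y; z]
    by apply: val_inj.
  move=> h; exists (x, y, z); last by apply: val_inj.
  by rewrite inE -occurrence_triple.
by rewrite inE -occurrence_triple => h ->.
Qed.

(** * Symmetries: inversion and rotation by 180 degrees *)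

Definition transpose_boxes (R : {set 'I_4 * 'I_4}) : {set 'I_4 * 'I_4} :=
  [set ab | (ab.2, ab.1) \in R].

Definition rotate_boxes (R : {set 'I_4 * 'I_4}) : {set 'I_4 * 'I_4} :=
  [set ab | (rev_ord ab.1, rev_ord ab.2) \in R].

Lemma value_tripleK (n : nat) (b : bool) (s : 'S_n) :
  cancel (value_triple b s) (value_triple b s^-1%g).
Proof. by move=> [[x y] z]; case: b; rewrite /value_triple /= !permK. Qed.

(** Replacing [m] by [s m] trades the position condition for the value condition. *)
Lemma respects_shading_inverse (n : nat) (R : {set 'I_4 * 'I_4}) (s : 'S_n)
    (t u : triple n) :
  respects_shading (transpose_boxes R) s^-1%g u t = respects_shading R s t u.
Proof.
apply/forall_inP/forall_inP => H [a b] Rab; apply/forallP => m.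
  have := forallP (H (b, a) _) (s m); rewrite inE /= => /(_ Rab).
  by rewrite permK andbC.
rewrite inE in Rab; have := forallP (H _ Rab) (s^-1%g m).
by rewrite permKV andbC.
Qed.

(** [value_triple b s] carries occurrences in [s] bijectively to occurrences in [s^-1]: 123 and 321
    are their own inverses, so only positions and values trade places. *)
Lemma num_occ_inverse (n : nat) (b : bool) (R : {set 'I_4 * 'I_4}) (s : 'S_n) :
  num_occ (monotone_perm b, transpose_boxes R) s^-1%g =
  num_occ (monotone_perm b, R) s.
Proof.
rewrite !num_occ_monotone -(card_preimset _ (can_inj (value_tripleK b s))).
apply: eq_card => t; rewrite !inE /monotone_occurrence value_tripleK.
by rewrite respects_shading_inverse andbCA.
Qed.

Definition rotate_perm (n : nat) (s : 'S_n) : 'S_n :=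
  (perm rev_ord_inj * s * perm rev_ord_inj)%g.

Lemma rotate_permE (n : nat) (s : 'S_n) (i : 'I_n) :
  rotate_perm s i = rev_ord (s (rev_ord i)).
Proof. by rewrite !permM !permE. Qed.

Lemma rotate_permK (n : nat) : involutive (@rotate_perm n).
Proof. by move=> s; apply/permP => i; rewrite !rotate_permE !rev_ordK. Qed.

Definition rotate_triple (n : nat) (t : triple n) : triple n :=
  (rev_ord t.2, rev_ord t.1.2, rev_ord t.1.1).

Lemma rotate_tripleK (n : nat) : involutive (@rotate_triple n).
Proof. by case=> [[x y] z]; rewrite /rotate_triple /= !rev_ordK. Qed.

Lemma increasing_rotate (n : nat) (t : triple n) :
  increasing (rotate_triple t) = increasing t.
Proof.
case: t => [[x y] z]; rewrite /increasing /=.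
by have := ltn_ord x; have := ltn_ord y; have := ltn_ord z; lia.
Qed.

Lemma value_triple_rotate (n : nat) (b : bool) (s : 'S_n) (t : triple n) :
  value_triple b (rotate_perm s) (rotate_triple t) =
  rotate_triple (value_triple b s t).
Proof. by case: t => [[x y] z]; case: b; rewrite /value_triple /= !rotate_permE !rev_ordK. Qed.

(** Reversal sends each boundary [c] to [n.+1 - c], so gap [a] becomes gap [3 - a]. *)
Lemma in_gap_rotate (n : nat) (t : triple n) (a : 'I_4) (m : 'I_n) :
  in_gap (cuts (rotate_triple t)) (rev_ord a) (rev_ord m).+1 =
  in_gap (cuts t) a m.+1.
Proof.
case: t a => [[x y] z] [[|[|[|[|//]]]] p]; rewrite /in_gap /=;
by have := ltn_ord x; have := ltn_ord y; have := ltn_ord z; have := ltn_ord m; lia.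
Qed.

Lemma respects_shading_rotate (n : nat) (R : {set 'I_4 * 'I_4}) (s : 'S_n)
    (t u : triple n) :
  respects_shading (rotate_boxes R) (rotate_perm s) (rotate_triple t)
    (rotate_triple u) = respects_shading R s t u.
Proof.
apply/forall_inP/forall_inP => H [a b] Rab; apply/forallP => m.
  have := forallP (H (rev_ord a, rev_ord b) _) (rev_ord m).
  rewrite inE /= !rev_ordK => /(_ Rab).
  by rewrite rotate_permE rev_ordK !in_gap_rotate.
rewrite inE in Rab; have := forallP (H _ Rab) (rev_ord m).
rewrite -[_ && _]/(in_gap (cuts t) (rev_ord a) (rev_ord m).+1 &&
  in_gap (cuts u) (rev_ord b) (s (rev_ord m)).+1).
by rewrite -in_gap_rotate -(in_gap_rotate u) !rev_ordK rotate_permE.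
Qed.

Lemma num_occ_rotate (n : nat) (b : bool) (R : {set 'I_4 * 'I_4}) (s : 'S_n) :
  num_occ (monotone_perm b, rotate_boxes R) (rotate_perm s) =
  num_occ (monotone_perm b, R) s.
Proof.
rewrite !num_occ_monotone -(card_preimset _ (can_inj (@rotate_tripleK n))).
apply: eq_card => t; rewrite !inE /monotone_occurrence value_triple_rotate.
by rewrite !increasing_rotate respects_shading_rotate.
Qed.

Lemma joint_count_transfer (n : nat) (R R' : {set 'I_4 * 'I_4})
    (f : 'S_n -> 'S_n) (k l : int) : injective f ->
  (forall b s, num_occ (monotone_perm b, R') (f s) =
               num_occ (monotone_perm b, R) s) ->
  joint_count (perm123, R') (perm321, R') n k l =
  joint_count (perm123, R) (perm321, R) n k l.
Proof.
move=> f_inj fE; rewrite /joint_count -(card_preimset _ f_inj).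
by apply: eq_card => s; rewrite !inE (fE false) (fE true).
Qed.

Lemma transpose_A35 : transpose_boxes A35 = A33.
Proof. by apply/setP => -[[[|[|[|[|//]]]] p] [[|[|[|[|//]]]] q]]; rewrite !inE. Qed.

Lemma rotate_A35 : rotate_boxes A35 = A36.
Proof. by apply/setP => -[[[|[|[|[|//]]]] p] [[|[|[|[|//]]]] q]]; rewrite !inE. Qed.

Lemma rotate_A33 : rotate_boxes A33 = A34.
Proof. by apply/setP => -[[[|[|[|[|//]]]] p] [[|[|[|[|//]]]] q]]; rewrite !inE. Qed.

(** Transposing [A35] gives [A33]; rotating these two gives [A36] and [A34]. *)
Lemma joint_count_A35 (R : {set 'I_4 * 'I_4}) (n : nat) (k l : int) :
  R \in [:: A33; A34; A35; A36] ->
  joint_count (perm123, R) (perm321, R) n k l =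
  joint_count (perm123, A35) (perm321, A35) n k l.
Proof.
have rot (S : {set 'I_4 * 'I_4}) := @joint_count_transfer n S _ (@rotate_perm n) k l
  (can_inj (@rotate_permK n)) (fun b => num_occ_rotate b S).
have inv33 : joint_count (perm123, A33) (perm321, A33) n k l =
             joint_count (perm123, A35) (perm321, A35) n k l.
  rewrite -transpose_A35; apply: (@joint_count_transfer n _ _ (fun s => s^-1%g)).
    exact: invg_inj.
  by move=> b s; apply: num_occ_inverse.
rewrite !inE => /or4P[] /eqP-> //.
  by rewrite -rotate_A33 rot.
by rewrite -rotate_A35 rot.
Qed.

(** * Occurrences for [A35] and their last positions *)

Lemma monotone_occurrence_A35 (n : nat) (b : bool) (s : 'S_n) (t : triple n) :
  monotone_occurrence b A35 s t =
  let u := value_triple b s t in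
  [&& increasing t, increasing u, t.1.2.+1 == t.2
    & [forall m : 'I_n, (m < t.2) ==> ~~ (u.1.1 < s m < u.1.2) && (s m <= u.2)]].
Proof.
rewrite /monotone_occurrence; set u := value_triple b s t; rewrite /=.
case ht: (increasing t); last by []; case hu: (increasing u); last by [].
have s_off m : m != t.1.1 -> m != t.1.2 -> m != t.2 ->
    [&& s m != u.1.1 :> nat, s m != u.1.2 :> nat & s m != u.2 :> nat].
  have neq (i j : 'I_n) : i != j -> s i != s j :> nat.
    by rewrite val_eqE (inj_eq perm_inj).
  by move=> /neq m1 /neq m2 /neq m3; rewrite /u; case: (b); apply/and3P.
have s_on m : m \in [:: t.1.1; t.1.2; t.2] -> s m \in [:: u.1.1; u.1.2; u.2].
  by rewrite !inE /u => /or3P[] /eqP->; case: (b); rewrite /= eqxx ?orbT.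
move: u ht hu s_off s_on => [[u v] w]; case: t => [[x y] z]; rewrite /increasing /=.
move=> ht hu s_off s_on; apply/forall_inP/andP => [H | [/eqP hyz /forallP H] [a c] Rac].
  have box i j (m : 'I_n) (p : i < 4) (q : j < 4) :
      (i, j) \in [:: (0,1); (0,3); (1,1); (1,3); (2,0); (2,1); (2,2); (2,3)] ->
      ~~ (in_gap (cuts (x, y, z)) i m.+1 && in_gap (cuts (u, v, w)) j (s m).+1).
    by move=> hij; apply: (forallP (H (Ordinal p, Ordinal q) _)); rewrite inE.
  rewrite /in_gap in box.
  split.
    (* Column 2 is shaded entirely, and a letter strictly between positions [y] and [z] would fall
       into one of its rows, since its value differs from those of the occurrence. *)
    have [//|neq] := boolP (y.+1 == z).
    have y1n : y.+1 < n by have := ltn_ord z; lia.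
    pose m := Ordinal y1n.
    have := s_off m; rewrite -!val_eqE /= => /(_ ltac:(lia) ltac:(lia) ltac:(lia)).
    have b0 := box 2 0 m isT isT isT; have b1 := box 2 1 m isT isT isT.
    have b2 := box 2 2 m isT isT isT; have b3 := box 2 3 m isT isT isT.
    rewrite /= in b0 b1 b2 b3; have := ltn_ord (s m); have := ltn_ord z; lia.
  (* Rows 1 and 3 are shaded in all columns left of [z], so an earlier letter off the occurrence
     lies neither between the two lower values nor above the highest. *)
  apply/forallP => m; apply/implyP => hm.
  have [/s_on|] := boolP (m \in [:: x; y; z]).
    rewrite !inE => /or3P[] /eqP ->; lia.
  rewrite !inE -!val_eqE /= => hoff.
  have b0 := box 0 1 m isT isT isT; have b1 := box 0 3 m isT isT isT.
  have b2 := box 1 1 m isT isT isT; have b3 := box 1 3 m isT isT isT.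
  have b4 := box 2 1 m isT isT isT; have b5 := box 2 3 m isT isT isT.
  rewrite /= in b0 b1 b2 b3 b4 b5; have := ltn_ord (s m); lia.
(* Adjacency empties column 2, and letters in columns 0 and 1 precede [z], where the hypothesis
   excludes rows 1 and 3. *)
apply/forallP => m; have := H m; move: Rac; rewrite inE /= /in_gap.
case: a c => [[|[|[|[|//]]]] p] [[|[|[|[|//]]]] q] //= _; lia.
Qed.

(* [f] lists the values of a permutation; the junk index [z.-1 = 0] at [z = 0]
   is excluded by [0 < z]. *)
Definition completes_123 (f : nat -> nat) (z : nat) : bool :=
  [&& 0 < z, [exists x : 'I_z, f x < f z.-1] & [forall m : 'I_z, f m < f z]].

Definition completes_321 (f : nat -> nat) (z : nat) : bool :=
  [&& 0 < z, f z < f z.-1, [exists x : 'I_z, f z.-1 < f x]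
    & [forall m : 'I_z, ~~ (f z < f m < f z.-1)]].

Definition completes (b : bool) : (nat -> nat) -> nat -> bool :=
  if b then completes_321 else completes_123.

(** A total function on [nat], with junk value 0 out of range, lets permutations of different sizes
    be compared index by index. *)
Definition values (n : nat) (s : 'S_n) (k : nat) : nat :=
  oapp (fun i : 'I_n => s i : nat) 0 (insub k).

Lemma valuesE (n : nat) (s : 'S_n) (i : 'I_n) : values s i = s i.
Proof. by rewrite /values valK. Qed.

Lemma exists_ord_lt (n : nat) (z : 'I_n) (P : pred nat) :
  reflect (exists2 x : 'I_n, x < z & P x) [exists x : 'I_z, P x].
Proof.
apply: (iffP existsP) => [[x Px] | [x xz Px]].
  by exists (widen_ord (ltnW (ltn_ord z)) x) => //=.
by exists (Ordinal xz).
Qed.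

Lemma forall_ord_lt (n : nat) (z : 'I_n) (P : pred nat) :
  reflect (forall x : 'I_n, x < z -> P x) [forall x : 'I_z, P x].
Proof.
apply: (iffP forallP) => [H x xz | H x]; first exact: (H (Ordinal xz)).
exact: (H (widen_ord (ltnW (ltn_ord z)) x) (ltn_ord x)).
Qed.

(** Projection to the last position is injective on occurrences: the middle position is its
    predecessor, and the first letter is the maximum of the prefix for 321, or the largest value
    below the middle one for 123. The image consists of the positions satisfying [completes b]. *)
Lemma num_occ_A35 (n : nat) (b : bool) (s : 'S_n) :
  num_occ (monotone_perm b, A35) s = \sum_(z < n) completes b (values s) z.
Proof.
rewrite num_occ_monotone -(card_in_imset (f := fun t => t.2)).
  rewrite -sum1_card big_mkcond; apply: eq_bigr => z _ /=.
  rewrite -(mulnbl _ 1) muln1; congr nat_of_bool.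
  apply/imsetP/idP => [[[[x y] z']] | ].
    rewrite inE monotone_occurrence_A35 => /and4P[/= ht hu /eqP hyz /forallP H] /= zz.
    subst z'; rewrite /increasing /= in ht hu.
    have yE : z.-1 = y by lia.
    case: b hu H => /= hu H.
      apply/and4P; split; rewrite ?yE ?valuesE; try lia.
        by apply/(@exists_ord_lt n z (fun k => s y < values s k)); exists x; rewrite ?valuesE; lia.
      apply/(@forall_ord_lt n z (fun k => ~~ (s z < values s k < s y))) => m mz; rewrite valuesE.
      have := H m; lia.
    apply/and3P; split; rewrite ?yE ?valuesE; try lia.
      by apply/(@exists_ord_lt n z (fun k => values s k < s y)); exists x; rewrite ?valuesE; lia.
    apply/(@forall_ord_lt n z (fun k => values s k < s z)) => m mz; rewrite valuesE.
    have : s m != s z by rewrite (inj_eq perm_inj) -val_eqE /=; lia.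
    rewrite -val_eqE /=; have := H m; lia.
  have yP : z.-1 < n by have := ltn_ord z; lia.
  pose y := Ordinal yP; have yE : z.-1 = y by [].
  case: b => /= /andP[z0].
    rewrite yE !valuesE => /and3P[hzy].
    move=> /(@exists_ord_lt n z (fun k => s y < values s k)) [x0 x0z hx0].
    move=> /(@forall_ord_lt n z (fun k => ~~ (s z < values s k < s y))) H.
    rewrite valuesE in hx0.
    case: (@arg_maxnP _ x0 (fun k : 'I_n => k < z) (fun k => s k) x0z) => x xz hmax.
    have := hmax _ x0z => /= hx.
    have xy : x != y by apply/eqP => e; rewrite e in hx; lia.
    rewrite -val_eqE /= in xy.
    exists (x, y, z) => //; rewrite inE monotone_occurrence_A35.
    apply/and4P; split; rewrite /increasing /=; try lia.
    apply/forallP => m; apply/implyP => mz; have := hmax m mz; have := H m mz.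
    rewrite valuesE /=; lia.
  rewrite yE !valuesE => /andP[].
  move=> /(@exists_ord_lt n z (fun k => values s k < s y)) [x0 x0z hx0].
  move=> /(@forall_ord_lt n z (fun k => values s k < s z)) H.
  rewrite valuesE in hx0.
  have x0P : (x0 < z) && (s x0 < s y) by lia.
  case: (@arg_maxnP _ x0 (fun k : 'I_n => (k < z) && (s k < s y)) (fun k => s k) x0P) => x xz hmax.
  have xy : x != y by apply/eqP => e; rewrite e in xz; lia.
  rewrite -val_eqE /= in xy.
  exists (x, y, z) => //; rewrite inE monotone_occurrence_A35.
  have := H y; rewrite valuesE => hy.
  apply/and4P; split; rewrite /increasing /=; try lia.
  apply/forallP => m; apply/implyP => mz; have := hmax m; have := H m mz.
  rewrite valuesE /=; lia.
move=> [[x y] z] [[x' y'] z']; rewrite !inE !monotone_occurrence_A35 /=.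
move=> /and4P[ht hu /eqP hyz /forallP H] /and4P[ht' hu' /eqP hyz' /forallP H'] zz.
subst z'; have yy : y' = y by apply: val_inj => /=; lia.
subst y'; congr (_, _, _); apply: (@perm_inj _ s); apply: val_inj => /=.
rewrite /increasing /= in ht hu ht' hu' H H'.
(* Each of the two first letters obeys the extremal condition of the other, so their values
   agree. *)
have := H x'; have := H' x; case: b hu hu' {H H'} => /=; lia.
Qed.

(** * Appending a last value *)

Lemma lift_perm_bij (n : nat) (i : 'I_n.+1) :
  bijective (fun u : 'I_n.+1 * 'S_n => lift_perm i u.1 u.2).
Proof.
apply: inj_card_bij => [[p s] [q t] /= e|]; last first.
  by rewrite card_prod card_ord !card_Sn factS.
have pq : p = q by rewrite -(lift_perm_id i p s) e lift_perm_id.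
subst q; congr (_, _); apply/permP => k.
by apply: (@lift_inj _ p); rewrite -!(lift_perm_lift i) e.
Qed.

Section AppendLast.

Variables (n : nat) (p : 'I_n.+1) (s : 'S_n).

Lemma values_lift_perm (k : nat) :
  k < n -> values (lift_perm ord_max p s) k = bump p (values s k).
Proof.
move=> kn; pose i := Ordinal kn.
by rewrite -[k]/(val i) -[X in values _ X]lift_max !valuesE lift_perm_lift.
Qed.

Lemma values_lift_perm_last : values (lift_perm ord_max p s) n = p.
Proof. by rewrite -[n in LHS]/(val (@ord_max n)) valuesE lift_perm_id. Qed.

End AppendLast.

Lemma eq_completes (b : bool) (f g : nat -> nat) (z : nat) :
  (forall i j, i <= z -> j <= z -> (f i < f j) = (g i < g j)) ->
  completes b f z = completes b g z.
Proof.
move=> fg; have lt (i : 'I_z) : i <= z by exact: ltnW.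
case: b; rewrite /= /completes_123 /completes_321; congr andb.
  rewrite fg ?leq_pred //; congr [&& _, _ & _].
    by apply: eq_existsb => x; rewrite fg ?leq_pred.
  by apply: eq_forallb => x; rewrite !fg ?leq_pred.
congr andb; first by apply: eq_existsb => x; rewrite fg ?leq_pred.
by apply: eq_forallb => x; rewrite fg ?leq_pred.
Qed.

Lemma ltn_bump2 (h i j : nat) : (bump h i < bump h j) = (i < j).
Proof. by rewrite /bump; lia. Qed.

(** [bump p] is strictly increasing, so appending a value preserves the relative order within the
    prefix, on which alone [completes] depends. *)
Lemma completes_lift_perm (b : bool) (n : nat) (p : 'I_n.+1) (s : 'S_n) (z : nat) :
  z < n -> completes b (values (lift_perm ord_max p s)) z = completes b (values s) z.
Proof.
move=> zn; apply: eq_completes => i j iz jz.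
by rewrite !values_lift_perm ?ltn_bump2 //; lia.
Qed.

Section LastValue.

Variables (n : nat) (p : 'I_n.+2) (s : 'S_n.+1).

Lemma exists_value_lt :
  [exists x : 'I_n.+1, s x < s ord_max] = (s ord_max != ord0).
Proof.
rewrite -val_eqE /=; apply/existsP/idP => [[x] | h]; first by lia.
by exists (s^-1 ord0)%g; rewrite permKV /=; lia.
Qed.

Lemma exists_value_gt :
  [exists x : 'I_n.+1, s ord_max < s x] = (s ord_max != ord_max).
Proof.
have := ltn_ord (s ord_max); rewrite -val_eqE /= => h0.
apply/existsP/idP => [[x] | h]; first by have := ltn_ord (s x); lia.
by exists (s^-1 ord_max)%g; rewrite permKV /=; lia.
Qed.

Lemma values_lift_permE (x : 'I_n.+1) :
  values (lift_perm ord_max p s) x = bump p (s x).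
Proof. by rewrite values_lift_perm // valuesE. Qed.

Lemma completes_123_last :
  completes_123 (values (lift_perm ord_max p s)) n.+1 =
  (p == n.+1 :> nat) && (s ord_max != ord0).
Proof.
rewrite /completes_123 /= values_lift_perm_last -[n in values _ n]/(val (@ord_max n)).
rewrite values_lift_permE andbC; congr andb; last first.
  rewrite -exists_value_lt; apply: eq_existsb => x.
  by rewrite values_lift_permE ltn_bump2.
(* The letter of [s] with the largest value [n] stays below [p] after the lift only when [p] is
   [n.+1]. *)
apply/forallP/idP => [/(_ (s^-1 ord_max)%g) | /eqP pn x]; rewrite values_lift_permE.
  by rewrite permKV /bump /=; have := ltn_ord p; lia.
by rewrite /bump; have := ltn_ord (s x); lia.
Qed.

Lemma completes_321_last :
  completes_321 (values (lift_perm ord_max p s)) n.+1 =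
  (p == s ord_max :> nat) && (s ord_max != ord_max).
Proof.
rewrite /completes_321 /= values_lift_perm_last -[n in values _ n]/(val (@ord_max n)).
rewrite values_lift_permE andbCA andbC; congr andb; last first.
  rewrite -exists_value_gt; apply: eq_existsb => x.
  by rewrite values_lift_permE ltn_bump2.
have sn := ltn_ord (s ord_max).
apply/andP/idP => [[ps /forallP H] | /eqP pE]; last first.
  split; first by rewrite /bump; lia.
  by apply/forallP => x; rewrite values_lift_permE /bump; lia.
have pn : p < n.+1 by move: ps; rewrite /bump; lia.
(* The letter of [s] with value [p] is lifted to [p.+1]; it must not lie below the lifted last
   value, so the last value of [s] is at most [p]. *)
have := H (s^-1 (Ordinal pn))%g; rewrite values_lift_permE permKV /=.
move: ps; rewrite /bump. lia.
Qed.

End LastValue.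

(** This is [num_occ] for [A35] by [num_occ_A35], in a form where the last position splits off. *)
Definition occ_count (n : nat) (b : bool) (s : 'S_n) : nat :=
  \sum_(z < n) completes b (values s) z.

Lemma occ_count_lift_perm (n : nat) (b : bool) (p : 'I_n.+2) (s : 'S_n.+1) :
  occ_count b (lift_perm ord_max p s) =
  occ_count b s + (if b then (p == s ord_max :> nat) && (s ord_max != ord_max)
                   else (p == n.+1 :> nat) && (s ord_max != ord0)).
Proof.
rewrite /occ_count big_ord_recr /=; congr addn.
  by apply: eq_bigr => z _; rewrite completes_lift_perm.
by case: b => /=; rewrite (completes_321_last, completes_123_last).
Qed.

Lemma occ_count1 (b : bool) (s : 'S_1) : occ_count b s = 0.
Proof. by rewrite /occ_count big_ord1; case: b. Qed.

(** Each appended value adds at most one, and the second value adds none, because a sole value is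
    both minimal and maximal. *)
Lemma occ_count_le (n : nat) (b : bool) (s : 'S_n.+1) : occ_count b s <= n.-1.
Proof.
elim: n s => [|n IH] s; first by rewrite occ_count1.
have [g _ gK] := lift_perm_bij (@ord_max n.+1).
rewrite -(gK s); case: (g s) => p t /=; rewrite occ_count_lift_perm.
case: n IH t p {s g gK} => [|n] IH t p; last first.
  by apply: leq_trans (leq_add (IH t) _) _; [by case: (b); exact: leq_b1 | lia].
by rewrite occ_count1 !(ord1 (t _)) eqxx !andbF; case: (b).
Qed.

(** * Generating functions refined by the last value *)

Section GeneratingFunction.

Local Open Scope ring_scope.
Variables (A : comNzRingType) (x y : A).

Definition weight (n : nat) (s : 'S_n) : A :=
  x ^+ occ_count false s * y ^+ occ_count true s.

Definition gen_fun (n : nat) : A := \sum_(s : 'S_n) weight s.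

(* Index shift: [gen_fun_min n] and [gen_fun_max n] are parts of [gen_fun n.+1]. *)
Definition gen_fun_min (n : nat) : A :=
  \sum_(s : 'S_n.+1 | s ord_max == ord0) weight s.

Definition gen_fun_max (n : nat) : A :=
  \sum_(s : 'S_n.+1 | s ord_max == ord_max) weight s.

Lemma weight_lift_perm (n : nat) (p : 'I_n.+2) (s : 'S_n.+1) :
  weight (lift_perm ord_max p s) =
  weight s * ((if (p == n.+1 :> nat) && (s ord_max != ord0) then x else 1) *
    (if (p == s ord_max :> nat) && (s ord_max != ord_max) then y else 1)).
Proof.
rewrite /weight !occ_count_lift_perm !exprD mulrACA.
by congr (_ * (_ * _)); case: ifP.
Qed.

Lemma sum_lift_perm (n : nat) (F : 'S_n.+1 -> A) :
  \sum_s F s = \sum_(s : 'S_n) \sum_(p < n.+1) F (lift_perm ord_max p s).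
Proof.
rewrite exchange_big (pair_big predT predT) /=.
by rewrite (reindex _ (onW_bij _ (lift_perm_bij ord_max))).
Qed.

Lemma sum_lift_perm_last (n : nat) (q : 'I_n.+1) (F : 'S_n.+1 -> A) :
  \sum_(s : 'S_n.+1 | s ord_max == q) F s = \sum_(s : 'S_n) F (lift_perm ord_max q s).
Proof.
rewrite big_mkcond sum_lift_perm; apply: eq_bigr => s _.
rewrite (bigD1 q) //= lift_perm_id eqxx big1 ?addr0 // => p.
by rewrite lift_perm_id => /negbTE->.
Qed.

(** The factor is [b] plus [a - b] on [P]; this turns a condition on the last value into a multiple
    of [gen_fun_min] or [gen_fun_max]. *)
Lemma sum_mul_if (I : finType) (P : pred I) (w : I -> A) (a b : A) :
  \sum_i w i * (if P i then a else b) =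
  b * (\sum_i w i) + (a - b) * (\sum_(i | P i) w i).
Proof.
rewrite [X in _ + _ * X]big_mkcond !mulr_sumr -big_split /=.
by apply: eq_bigr => i _; case: (P i); ring.
Qed.

(** Appending 0 never earns [x], and earns [y] exactly when the last value is 0: that value is not
    maximal, since [s] has at least two letters. *)
Lemma gen_fun_minS (n : nat) :
  gen_fun_min n.+2 = gen_fun n.+2 + (y - 1) * gen_fun_min n.+1.
Proof.
rewrite /gen_fun_min sum_lift_perm_last -[X in X + _]mul1r -sum_mul_if.
apply: eq_bigr => s _; rewrite weight_lift_perm /= mul1r; congr (_ * _).
by rewrite -!val_eqE /= eq_sym; case: (s ord_max : nat).
Qed.

(** Appending the maximum earns [x] unless the last value of [s] is minimal; [y] would require a
    last value [n.+1], which is out of range. *)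
Lemma gen_fun_maxS (n : nat) :
  gen_fun_max n.+1 = x * gen_fun n.+1 + (1 - x) * gen_fun_min n.
Proof.
rewrite /gen_fun_max sum_lift_perm_last -sum_mul_if.
apply: eq_bigr => s _; rewrite weight_lift_perm /= eqxx; congr (_ * _).
have /negbTE-> : n.+1 != s ord_max :> nat by have := ltn_ord (s ord_max); lia.
by rewrite mulr1; case: (s ord_max == ord0).
Qed.

(** Of the [n.+2] values to append, [n.+1] earns [x] unless the last value of [s] is minimal, that
    last value itself earns [y] unless it is maximal, and the other [n] earn 1. *)
Lemma gen_funS (n : nat) :
  gen_fun n.+2 = (n%:R + x + y) * gen_fun n.+1 + (1 - x) * gen_fun_min n
                 + (1 - y) * gen_fun_max n.
Proof.
transitivity (\sum_(s : 'S_n.+1) (weight s * n%:R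
   + weight s * (if s ord_max == ord0 then 1 else x)
   + weight s * (if s ord_max == ord_max then 1 else y))); last first.
  by rewrite !big_split /= !sum_mul_if -mulr_suml /gen_fun /gen_fun_min /gen_fun_max; ring.
rewrite /gen_fun sum_lift_perm; apply: eq_bigr => s _.
under eq_bigr => p _ do rewrite weight_lift_perm.
rewrite -mulr_sumr -!mulrDr; congr (_ * _).
have sn := ltn_ord (s ord_max).
rewrite big_ord_recr /= eqxx /=.
have /negbTE-> : n.+1 != s ord_max :> nat by lia.
rewrite mulr1 (bigD1 (s ord_max)) //= eqxx /=.
rewrite (eq_bigr (fun=> 1)) => [|p]; last first.
  rewrite -val_eqE /= => /negbTE-> /=.
  have /negbTE-> : p != n.+1 :> nat by have := ltn_ord p; lia.
  by rewrite mulr1.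
rewrite sumr_const cardC1 card_ord /=.
have /negbTE-> : s ord_max != n.+1 :> nat by lia.
rewrite !if_neg mul1r; case: ifP => _; case: ifP => _; ring.
Qed.

(** The terms in [gen_fun_min n.+1] cancel, as [(1 - x) * (y - 1) + (1 - y) * (1 - x) = 0], and
    [(1 - x) + (1 - y) * x = 1 - x * y] remains. *)
Lemma gen_fun_rec (n : nat) :
  gen_fun n.+4 = (n.+2%:R + x + y) * gen_fun n.+3 + (1 - x * y) * gen_fun n.+2.
Proof. by rewrite gen_funS gen_fun_minS gen_fun_maxS; ring. Qed.

Lemma gen_fun1 : gen_fun 1 = 1 /\ gen_fun_min 0 = 1 /\ gen_fun_max 0 = 1.
Proof.
have w (s : 'S_1) : weight s = 1 by rewrite /weight !occ_count1 mulr1.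
have u : \sum_(s : 'S_1) (1 : A) = 1 by rewrite sumr_const card_Sn.
rewrite /gen_fun /gen_fun_min /gen_fun_max.
have o (i j : 'I_1) : i == j by rewrite (ord1 i) (ord1 j).
by split; [|split]; rewrite -[RHS]u; apply: eq_big => [s|s _]; rewrite ?w ?o.
Qed.

Lemma gen_fun2 : gen_fun 2 = 2%:R.
Proof. by have [T [F L]] := gen_fun1; rewrite gen_funS T F L; ring. Qed.

Lemma gen_fun3 : gen_fun 3 = x + y + 4%:R.
Proof.
have [T [F L]] := gen_fun1.
(* [gen_fun_minS] starts at three letters, so the two-letter case is computed directly. *)
have F1 : gen_fun_min 1 = 1.
  rewrite -[RHS]T /gen_fun_min sum_lift_perm_last; apply: eq_bigr => s _.
  by rewrite weight_lift_perm !(ord1 (s _)) eqxx !andbF !mulr1.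
by rewrite gen_funS gen_fun_maxS gen_fun2 F1 T F; ring.
Qed.

End GeneratingFunction.

(** * Coefficients: recurrence, initial values and symmetry *)

Local Open Scope ring_scope.

Definition occ_poly (n : nat) : {poly {poly int}} := gen_fun 'X 'Y n.

Definition occ_coef (n : nat) (k l : int) : int :=
  (joint_count (perm123, A35) (perm321, A35) n k l)%:Z.

Lemma joint_countE (n k l : nat) :
  joint_count (perm123, A35) (perm321, A35) n k%:Z l%:Z =
  #|[set s : 'S_n | (occ_count false s == k) && (occ_count true s == l)]|.
Proof.
rewrite /joint_count; apply: eq_card => s; rewrite !inE.
by rewrite (num_occ_A35 false) (num_occ_A35 true).
Qed.

Lemma joint_count_neg (n : nat) (k l : int) : (k < 0) || (l < 0) ->
  joint_count (perm123, A35) (perm321, A35) n k l = 0%N.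
Proof.
move=> neg; apply: eq_card0 => s; rewrite !inE; apply/negP => /andP[/eqP ek /eqP el].
by move: neg; rewrite -ek -el; lia.
Qed.

Lemma joint_count_ge (n : nat) (k l : int) : (2 <= n)%N ->
  (n%:Z - 1 <= k) || (n%:Z - 1 <= l) ->
  joint_count (perm123, A35) (perm321, A35) n k l = 0%N.
Proof.
case: n => [//|n] n2 big; apply: eq_card0 => s; rewrite !inE.
rewrite (num_occ_A35 false) (num_occ_A35 true).
have := occ_count_le false s; have := occ_count_le true s.
rewrite -![\sum_(z < _) _]/(occ_count _ s) => h1 h2.
apply/negP => /andP[/eqP ek /eqP el]; move: big; rewrite -ek -el; lia.
Qed.

Lemma natr_joint_count (S : pzSemiRingType) (n k l : nat) :
  (joint_count (perm123, A35) (perm321, A35) n k%:Z l%:Z)%:R =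
  \sum_(s : 'S_n) ((occ_count false s == k) && (occ_count true s == l))%:R :> S.
Proof.
rewrite joint_countE -sum1_card natr_sum big_mkcond /=; apply: eq_bigr => s _.
by rewrite inE; case: (_ && _).
Qed.

(* The coefficient of x^k y^l, extended by 0 to negative exponents. *)
Definition coefxy (p : {poly {poly int}}) (k l : int) : int :=
  match k, l with
  | Posz i, Posz j => p`_i`_j
  | _, _ => 0
  end.

Lemma coefxyD (p q : {poly {poly int}}) (k l : int) :
  coefxy (p + q) k l = coefxy p k l + coefxy q k l.
Proof. by case: k => [k|k]; case: l => [l|l] //=; rewrite !coefD. Qed.

Lemma coefxyN (p : {poly {poly int}}) (k l : int) :
  coefxy (- p) k l = - coefxy p k l.
Proof. by case: k => [k|k]; case: l => [l|l] //=; rewrite !coefN. Qed.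

Lemma coefxyMn (m : nat) (p : {poly {poly int}}) (k l : int) :
  coefxy (m%:R * p) k l = m%:Z * coefxy p k l.
Proof.
case: k => [k|k]; case: l => [l|l] /=; rewrite ?mulr0 //.
by rewrite mulr_natl !coefMn -mulr_natl natz.
Qed.

(** The zero extension makes the shift valid at [k = 0] too, where both sides vanish. *)
Lemma coefxyMX (p : {poly {poly int}}) (k l : int) :
  coefxy ('X * p) k l = coefxy p (k - 1) l.
Proof.
have predE (i : nat) : i.+1%:Z - 1 = i by lia.
case: k => [[|k]|k]; case: l => [l|l]; rewrite ?predE //=;
  by rewrite coefXM ?coef0.
Qed.

Lemma coefxyMY (p : {poly {poly int}}) (k l : int) :
  coefxy ('Y * p) k l = coefxy p k (l - 1).
Proof.
have predE (i : nat) : i.+1%:Z - 1 = i by lia.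
by case: k => [k|k]; case: l => [[|l]|l]; rewrite ?predE //= coefCM coefXM.
Qed.

Lemma coef_occ_poly (n k l : nat) : (occ_poly n)`_k`_l = occ_coef n k%:Z l%:Z.
Proof.
rewrite /occ_coef -natz natr_joint_count /occ_poly /gen_fun !coef_sum.
apply: eq_bigr => s _; rewrite /weight -rmorphXn /= coefMC coefXn.
rewrite (eq_sym k); case: eqP => _ /=; last by rewrite mul0r coef0.
by rewrite mul1r coefXn eq_sym.
Qed.

(** By [occ_count_le] both exponents stay below [n.-1], so the truncated double sum picks up the
    monomial of every permutation exactly once. *)
Lemma joint_polyE (n : nat) : (2 <= n)%N ->
  joint_poly (perm123, A35) (perm321, A35) n = occ_poly n.
Proof.
case: n => [//|n] n2; rewrite /joint_poly /occ_poly /gen_fun /=.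
under eq_bigr => k _ do under eq_bigr => l _ do
  rewrite natr_joint_count !mulr_suml.
under eq_bigr => k _ do rewrite exchange_big.
rewrite exchange_big; apply: eq_bigr => s _ /=.
have lt b : (occ_count b s < n)%N by have := occ_count_le b s; lia.
rewrite big_mkord (bigD1 (Ordinal (lt false))) //= [X in _ + X]big1 ?addr0 => [|k].
  rewrite big_mkord (bigD1 (Ordinal (lt true))) //= [X in _ + X]big1 ?addr0 => [|l].
    by rewrite !eqxx mul1r.
  rewrite -val_eqE /= eq_sym => /negbTE->.
  by rewrite andbF !mul0r.
rewrite -val_eqE /= eq_sym => /negbTE->.
by rewrite big1 // => l _; rewrite !mul0r.
Qed.

Lemma occ_coefE (n : nat) (k l : int) :
  occ_coef n k l = coefxy (occ_poly n) k l.
Proof.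
case: k => [k|k]; last by rewrite /occ_coef joint_count_neg.
case: l => [l|l]; last by rewrite /occ_coef joint_count_neg ?orbT.
by rewrite /= coef_occ_poly.
Qed.

Lemma occ_coef_rec (n : nat) (k l : int) : (4 <= n)%N ->
  occ_coef n k l = (n%:Z - 2) * occ_coef (n - 1)%N k l
                   + occ_coef (n - 1)%N (k - 1) l + occ_coef (n - 1)%N k (l - 1)
                   + occ_coef (n - 2)%N k l - occ_coef (n - 2)%N (k - 1) (l - 1).
Proof.
case: n => [|[|[|[|n]]]] // _; rewrite !subSS subn0.
have -> : n.+4%:Z - 2 = n.+2%:Z by lia.
rewrite !occ_coefE [occ_poly n.+4]gen_fun_rec -!/(occ_poly _).
set P := occ_poly n.+3; set Q := occ_poly n.+2.
(* Each product becomes a numeral, ['X] or ['Y] times a polynomial, the shapes whose coefficients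
   are known. *)
have -> : (n.+2%:R + 'X + 'Y) * P + (1 - 'X * 'Y) * Q =
  n.+2%:R * P + 'X * P + 'Y * P + Q - 'X * ('Y * Q) by ring.
by rewrite !coefxyD coefxyN !coefxyMX !coefxyMY coefxyMn.
Qed.

Lemma occ_poly2 : occ_poly 2 = 2%:R.
Proof. exact: gen_fun2. Qed.

Lemma occ_poly3 : occ_poly 3 = 'X + 'Y + 4%:R.
Proof. exact: gen_fun3. Qed.

Lemma coefxy1 (k l : int) : coefxy 1 k l = ((k == 0) && (l == 0))%:R.
Proof.
case: k => [[|k]|k]; case: l => [[|l]|l] //=;
by rewrite coef1 /= ?coef1 ?coef0.
Qed.

Lemma occ_coef1 (k l : int) : occ_coef 1 k l = coefxy 1 k l.
Proof.
by rewrite occ_coefE [occ_poly 1](gen_fun1 ('X : {poly {poly int}}) 'Y).1.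
Qed.

Lemma occ_coef2 (k l : int) : occ_coef 2 k l = 2 * coefxy 1 k l.
Proof. by rewrite occ_coefE occ_poly2 -[2%:R]mulr1 coefxyMn. Qed.

Lemma occ_coef3 (k l : int) :
  occ_coef 3 k l = coefxy 1 (k - 1) l + coefxy 1 k (l - 1) + 4 * coefxy 1 k l.
Proof.
rewrite occ_coefE occ_poly3 -['X]mulr1 -['Y]mulr1 -[4%:R]mulr1 !coefxyD.
by rewrite coefxyMX coefxyMY coefxyMn.
Qed.

Lemma coefxy1_sym (k l : int) : coefxy 1 k l = coefxy 1 l k.
Proof. by rewrite !coefxy1 andbC. Qed.

(** The recurrence is invariant under exchanging [k] and [l], and sizes 1, 2 and 3 are symmetric by
    their explicit coefficients. *)
Lemma occ_coef_sym (n : nat) (k l : int) : (1 <= n)%N ->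
  occ_coef n k l = occ_coef n l k.
Proof.
elim/ltn_ind: n k l => -[|[|[|[|n]]]] IH k l // _.
- by rewrite !occ_coef1 coefxy1_sym.
- by rewrite !occ_coef2 coefxy1_sym.
- rewrite !occ_coef3 (coefxy1_sym k) (coefxy1_sym (k - 1)) (coefxy1_sym k).
  by congr (_ + _); rewrite addrC.
rewrite (@occ_coef_rec n.+4 k) // (@occ_coef_rec n.+4 l) // !subSS !subn0.
have sym3 i j : occ_coef n.+3 i j = occ_coef n.+3 j i by exact: IH.
have sym2 i j : occ_coef n.+2 i j = occ_coef n.+2 j i by exact: IH.
rewrite (sym3 k l) (sym3 (k - 1) l) (sym3 k (l - 1)) (sym2 k l).
by rewrite (sym2 (k - 1)) [X in X + _ - _]addrAC.
Qed.

(** * Conclusion for all four shadings *)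

Lemma joint_poly_A35 (R : {set 'I_4 * 'I_4}) (n : nat) :
  R \in [:: A33; A34; A35; A36] -> (2 <= n)%N ->
  joint_poly (perm123, R) (perm321, R) n = occ_poly n.
Proof.
move=> hR n2; rewrite -joint_polyE // /joint_poly.
by apply: eq_bigr => k _; apply: eq_bigr => l _; rewrite joint_count_A35.
Qed.

Theorem theorem3p4 (R : {set 'I_4 * 'I_4})
    (hR : R \in [:: A33; A34; A35; A36]) :
  let q1 : mesh_pattern 3 := (perm123, R) in
  let q2 : mesh_pattern 3 := (perm321, R) in
  let T (n : nat) (k l : int) : int := (joint_count q1 q2 n k l)%:Z in
  let TP (n : nat) : {poly {poly int}} := joint_poly q1 q2 n in
  [/\ jointly_equidistributed q1 q2,
      (forall (n : nat) (k l : int), (4 <= n)%N ->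
         T n k l = (n%:Z - 2) * T (n - 1)%N k l
                   + T (n - 1)%N (k - 1) l + T (n - 1)%N k (l - 1)
                   + T (n - 2)%N k l - T (n - 2)%N (k - 1) (l - 1)),
      [/\ T 2%N 0 0 = 2, T 3%N 0 0 = 4, T 3%N 1 0 = 1, T 3%N 0 1 = 1
        & forall (n : nat) (k l : int), (2 <= n)%N ->
            (n%:Z - 1 <= k) || (n%:Z - 1 <= l) -> T n k l = 0],
      (forall n : nat, (4 <= n)%N ->
         TP n = (n%:R + 'X + 'Y - 2%:R) * TP (n - 1)%N
                + (1 - 'X * 'Y) * TP (n - 2)%N)
    & TP 2%N = 2%:R /\ TP 3%N = 'X + 'Y + 4%:R].
Proof.
move=> q1 q2 T TP.
have TE n k l : T n k l = occ_coef n k l by rewrite /T joint_count_A35.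
have TPE n : (2 <= n)%N -> TP n = occ_poly n by exact: joint_poly_A35.
split.
(* The symmetry is known for integer coefficients, so the equality of counts is moved along the
   injection of [nat] into [int]. *)
- move=> n k l n1; apply: (can_inj absz_nat).
  by rewrite -![Posz (joint_count _ _ _ _ _)]/(T _ _ _) !TE occ_coef_sym.
- by move=> n k l n4; rewrite !TE occ_coef_rec.
- split; rewrite ?TE ?occ_coef2 ?occ_coef3 ?coefxy1 //.
  by move=> n k l n2 big; rewrite TE /occ_coef joint_count_ge.
- move=> n n4; rewrite !TPE; [|lia..].
  case: n n4 => [|[|[|[|n]]]] // _; rewrite !subSS subn0.
  by rewrite [occ_poly n.+4]gen_fun_rec -!/(occ_poly _); ring.
- by rewrite !TPE // occ_poly2 occ_poly3.
Qed.
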